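(* Let $M$ be a matroid on a finite ground set $E$, and let $e\in E$. If $e$ is not a loop of $M$, then for every $i$, $$L_i(M-e,M/e)=\bigoplus_{\substack{C\in\mathcal C(M)\\ e\in C}} L_i\bigl((C\setminus\{e\})\circ IN(M/C)\bigr),$$ where $L_i(M-e,M/e)$ denotes $L_i(IN(M)-e,\,IN(M)/e)$ and $\mathcal C(M)$ is the set of circuits of $M$.
   Context: A simplicial complex $\Delta$ on a finite vertex set $V$ is a collection of subsets of $V$ (faces) closed under taking subsets; the empty set is a face of dimension $-1$ of every complex having at least one face. Put $\dim F=|F|-1$. A simplicial pair $(\Delta,\Delta')$ consists of two simplicial complexes on the same vertex set; pairs with the same set difference $\Delta\setminus\Delta'$ are identified, and a pair is thus determined by the set of faces $\Delta\setminus\Delta'$. For $i\ge -1$, $C_i(\Delta,\Delta';\mathbb R)$ is the real vector space of formal linear combinations of oriented $i$-dimensional faces $[F]$, $F\in\Delta\setminus\Delta'$, and $\partial_i\colon C_i\to C_{i-1}$ is the usual signed simplicial boundary operator with all terms outside $\Delta\setminus\Delta'$ dropped; $\partial_i^*$ is its adjoint (transposed matrix in the natural bases). The Laplacian is $L_i(\Delta,\Delta')=\partial_{i+1}\partial_{i+1}^*+\partial_i^*\partial_i$, a linear operator on $C_i(\Delta,\Delta';\mathbb R)$. For a complex $\Delta$ and $e\in V$: $\Delta-e=\{F\in\Delta:e\notin F\}$ and $\Delta/e=\{F\setminus\{e\}:F\in\Delta,\ e\in F\}$, both on vertex set $V\setminus\{e\}$. $IN(M)$ is the simplicial complex on $E$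 whose faces are the independent sets of $M$, and $M/C$ is the matroid contraction of $M$ by $C$. If $A$ is a finite set disjoint from the vertex set of a simplicial complex $\Delta$, then $A\circ\Delta=\{A\cup F: F\in\Delta\}$; this is (the set of faces of) a simplicial pair, namely $(2^A*\Delta,\ (2^A\setminus\{A\})*\Delta)$, where $*$ is the join $\Delta_1*\Delta_2=\{F\cup G:F\in\Delta_1,G\in\Delta_2\}$. The direct sum is understood with respect to the decomposition of chain spaces $C_i$ into coordinate subspaces: the set of faces of $(IN(M)-e,IN(M)/e)$ is the disjoint union of the sets of faces $(C\setminus\{e\})\circ IN(M/C)$ over the circuits $C$ containing $e$, and $L_i$ respects this decomposition. If no circuit contains $e$ the direct sum is zero. *)

(* Defs.v *)
From HB Require Import structures.
From mathcomp Require Import all_boot all_order all_algebra.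
From mathcomp Require Import reals.

Set Implicit Arguments.
Unset Strict Implicit.
Unset Printing Implicit Defensive.

Import Order.TTheory GRing.Theory Num.Theory.
Local Open Scope ring_scope.

Record matroid (T : finType) := Matroid {
  ground : {set T};
  indep : {set {set T}};
  indep_sub_ground : forall I : {set T}, I \in indep -> I \subset ground;
  indep0 : set0 \in indep;
  indepS : forall I J : {set T}, I \subset J -> J \in indep -> I \in indep;
  indep_aug : forall I J : {set T}, I \in indep -> J \in indep -> (#|I| < #|J|)%N ->
    exists2 x, x \in J :\: I & x |: I \in indep
}.

Section Matroid.
Variables (T : finType) (M : matroid T).
Implicit Types B C I J : {set T}.

Definition loop (e : T) : bool :=
  (e \in ground M) && ([set e] \notin indep M).

Definition circuits : {set {set T}} :=
  [set C : {set T} | minset [pred D : {set T} | (D \subset ground M) && (D \notin indep M)] C].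

Definition basis_in (C B : {set T}) : bool :=
  maxset [pred I : {set T} | (I \subset C) && (I \in indep M)] B.

Definition contract_indep (C : {set T}) : {set {set T}} :=
  [set I : {set T} | (I \subset ground M :\: C)
           && [exists B, basis_in C B && (I :|: B \in indep M)]].

Lemma ex_basis_in C : exists B, basis_in C B.
Proof.
have [|B bB] := @ex_maxset _ [pred I : {set T} | (I \subset C) && (I \in indep M)].
  by exists set0; rewrite /= sub0set indep0.
by exists B.
Qed.

Lemma basis_inP C B :
  basis_in C B -> B \subset C /\ B \in indep M.
Proof. by move/maxsetp; rewrite inE => /andP[]. Qed.

Lemma basis_in_aug C B x :
  basis_in C B -> x \in C -> x |: B \in indep M -> x \in B.
Proof.
move=> /maxsetP[+ maxB] xC xB; rewrite inE => /andP[BC _].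
rewrite -(maxB (x |: B)) ?subsetUr ?setU11 //.
by rewrite inE xB subUset sub1set xC BC.
Qed.

Lemma leq_card_basis_in C B B' :
  basis_in C B -> basis_in C B' -> (#|B'| <= #|B|)%N.
Proof.
move=> bB bB'; have [BC BI] := basis_inP bB; have [BC' BI'] := basis_inP bB'.
rewrite leqNgt; apply/negP => /(indep_aug BI BI') [x].
rewrite inE => /andP[xB xB'] /(basis_in_aug bB (subsetP BC' _ xB')).
by rewrite (negPf xB).
Qed.

Lemma contract_indep_sub C I :
  I \in contract_indep C -> I \subset ground M :\: C.
Proof. by rewrite inE => /andP[]. Qed.

Lemma contract_indep0 C : set0 \in contract_indep C.
Proof.
rewrite inE sub0set /=; have [B bB] := ex_basis_in C.
by apply/existsP; exists B; rewrite bB set0U (basis_inP bB).2.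
Qed.

Lemma contract_indepS C I J :
  I \subset J -> J \in contract_indep C -> I \in contract_indep C.
Proof.
rewrite !inE => IJ /andP[JE /existsP[B /andP[bB JB]]].
rewrite (subset_trans IJ JE); apply/existsP; exists B.
by rewrite bB (indepS _ JB) // setSU.
Qed.

Lemma contract_indep_aug C I J :
  I \in contract_indep C -> J \in contract_indep C -> (#|I| < #|J|)%N ->
  exists2 x, x \in J :\: I & x |: I \in contract_indep C.
Proof.
have cardUB (K B : {set T}) : K \subset ground M :\: C -> basis_in C B ->
    #|K :|: B| = (#|K| + #|B|)%N.
  rewrite subsetD => /andP[_ KC] /basis_inP[BC _].
  by apply/eqP; rewrite leq_card_setU (disjointWr BC KC).
rewrite !inE => /andP[IE /existsP[B /andP[bB IB]]].
move=> /andP[JE /existsP[B' /andP[bB' JB']]] IJ.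
have [|x] := indep_aug IB JB'.
  rewrite (cardUB I B IE bB) (cardUB J B' JE bB').
  by rewrite -addSn leq_add // (leq_card_basis_in bB').
rewrite !inE negb_or => /andP[/andP[xI xB] /orP[xJ|xB']] xIB.
  exists x; first by rewrite inE xI.
  rewrite !inE subUset sub1set (subsetP JE _ xJ) IE /=.
  by apply/existsP; exists B; rewrite bB -setUA.
have xC := subsetP (basis_inP bB').1 _ xB'.
move: xB; rewrite (basis_in_aug bB xC) //.
by apply: indepS xIB; rewrite setUS // subsetUr.
Qed.

Definition contract (C : {set T}) : matroid T :=
  Matroid (@contract_indep_sub C) (contract_indep0 C)
    (@contract_indepS C) (@contract_indep_aug C).

End Matroid.

(* The complex without any face is allowed. *)
Record complex (T : finType) := Complex {
  vertices : {set T};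
  faces : {set {set T}};
  faces_sub : forall F : {set T}, F \in faces -> F \subset vertices;
  faces_closed : forall F G : {set T}, F \subset G -> G \in faces -> F \in faces
}.

Section Complex.
Variable T : finType.
Implicit Types (D : complex T) (e : T) (F G A : {set T}).

Definition IN (M : matroid T) : complex T :=
  Complex (@indep_sub_ground T M) (@indepS T M).

Definition del_faces D e := [set F : {set T} in faces D | e \notin F].

Lemma del_faces_sub D e F :
  F \in del_faces D e -> F \subset vertices D :\ e.
Proof. by rewrite inE subsetD1 => /andP[/faces_sub-> ->]. Qed.

Lemma del_faces_closed D e F G :
  F \subset G -> G \in del_faces D e -> F \in del_faces D e.
Proof.
rewrite !inE => FG /andP[GD eG]; rewrite (faces_closed FG GD) /=.
by apply: contra eG; apply: subsetP.
Qed.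

Definition del D e : complex T :=
  Complex (@del_faces_sub D e) (@del_faces_closed D e).

Definition link_faces D e := [set F :\ e | F in [set F : {set T} in faces D | e \in F]].

Lemma link_faces_sub D e F :
  F \in link_faces D e -> F \subset vertices D :\ e.
Proof. by case/imsetP=> G; rewrite inE => /andP[/faces_sub GD _] ->; apply: setSD. Qed.

Lemma link_faces_closed D e F G :
  F \subset G -> G \in link_faces D e -> F \in link_faces D e.
Proof.
move=> FG /imsetP[H]; rewrite inE => /andP[HD eH] GH.
have := subset_trans FG (_ : G \subset H :\ e); rewrite GH subxx => /(_ isT).
rewrite subsetD1 => /andP[FH eF].
apply/imsetP; exists (e |: F); last by rewrite setU1K.
by rewrite inE setU11 andbT (faces_closed _ HD) // subUset sub1set eH.
Qed.

Definition link D e : complex T :=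
  Complex (@link_faces_sub D e) (@link_faces_closed D e).

Definition circ A D : {set {set T}} := [set A :|: F | F in faces D].

Definition join_faces (X Y : {set {set T}}) := [set F :|: G | F in X, G in Y].

Lemma circ_pairE A D : [disjoint A & vertices D] ->
  circ A D = join_faces (powerset A) (faces D)
             :\: join_faces (powerset A :\ A) (faces D).
Proof.
move=> dA; apply/setP => K; rewrite inE; apply/imsetP/andP.
- case=> F FD ->; split; last by apply: imset2_f; rewrite ?powersetE.
  apply/negP => /imset2P[B G]; rewrite in_setD1 powersetE.
  move=> /andP[BnA BA] GD eqK; case/eqP: BnA; apply/eqP.
  rewrite eqEsubset BA /=; apply/subsetP => x xA.
  have: x \in B :|: G by rewrite -eqK inE xA.
  rewrite inE => /orP[//|/(subsetP (faces_sub GD))].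
  by rewrite (disjointFr dA xA).
- case=> nK /imset2P[B F]; rewrite powersetE => BA FD eqK; exists F => //.
  case: (eqVneq B A) => [<- //|BnA]; case/negP: nK; rewrite eqK.
  by apply: imset2_f => //; rewrite in_setD1 BnA powersetE.
Qed.

End Complex.

Section Chains.
Variables (R : realType) (d : Order.disp_t) (T : finOrderType d).
Implicit Types (X Y : {set {set T}}) (F G : {set T}) (i j : int).

Definition dim F : int := #|F|%:Z - 1.

(* A simplicial pair is represented by its set of faces X. *)
Definition face X i := {F : {set T} | (F \in X) && (dim F == i)}.

(* Coordinates are taken in the basis of the faces [F], each oriented by the
   order of T. *)
Definition chain X i := {ffun face X i -> R^o}.

Definition mat_fun (I J : finType) (a : J -> I -> R) (x : {ffun I -> R^o}) :
    {ffun J -> R^o} :=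
  [ffun j => \sum_k a j k * x k].

Lemma mat_fun_is_linear (I J : finType) (a : J -> I -> R) :
  linear (mat_fun a).
Proof.
move=> c u v; apply/ffunP => l; rewrite !ffunE scaler_sumr -big_split /=.
by apply: eq_bigr => k _; rewrite !ffunE mulrDr /GRing.scale /= mulrCA.
Qed.

HB.instance Definition _ (I J : finType) (a : J -> I -> R) :=
  GRing.isLinear.Build R {ffun I -> R^o} {ffun J -> R^o} *:%R (mat_fun a)
    (mat_fun_is_linear a).

Definition hom_of (I J : finType) (a : J -> I -> R) :
    'Hom({ffun I -> R^o}, {ffun J -> R^o}) := linfun (mat_fun a).

Lemma hom_ofE (I J : finType) (a : J -> I -> R) (x : {ffun I -> R^o}) (j : J) :
  hom_of a x j = \sum_k a j k * x k.
Proof. by rewrite lfunE ffunE. Qed.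

Definition natural_basis (I : finType) (k : I) : {ffun I -> R^o} :=
  [ffun l => (l == k)%:R].

(* Transposed matrix in the natural bases. *)
Definition adjoint (I J : finType)
    (f : 'Hom({ffun I -> R^o}, {ffun J -> R^o})) :
    'Hom({ffun J -> R^o}, {ffun I -> R^o}) :=
  hom_of (fun k l => f (natural_basis k) l).

(* Coefficient of [G] in the boundary of [F]; at most one v contributes. *)
Definition incidence F G : R :=
  \sum_(v in F | F :\ v == G) (-1) ^+ #|[set u in F | (u < v)%O]|.

(* The boundary C_i -> C_j, where j is meant to be i - 1; a separate j avoids
   transports between the types chain X i and chain X (i + 1 - 1). *)
Definition boundary X i j : 'Hom(chain X i, chain X j) :=
  hom_of (fun (G : face X j) (F : face X i) => incidence (val F) (val G)).

Definition laplacian X i : 'End(chain X i) :=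
  (boundary X (i + 1) i \o adjoint (boundary X (i + 1) i))%VF
  + (adjoint (boundary X i (i - 1)) \o boundary X i (i - 1))%VF.

(* [F] |-> [F] if F is in Y, and [F] |-> 0 otherwise: the inclusion of a
   coordinate subspace if X is contained in Y, and the projection onto a
   coordinate subspace if Y is contained in X. *)
Definition coord_map X Y i : 'Hom(chain X i, chain Y i) :=
  hom_of (fun (G : face Y i) (F : face X i) => (val F == val G)%:R).

(* Direct sum of the operators A c on the chains of Y c, as an operator on the
   chains of X, for X the disjoint union of the Y c with P c. *)
Definition dirsum (I : finType) (P : pred I) (Y : I -> {set {set T}}) X i
    (A : forall c, 'End(chain (Y c) i)) : 'End(chain X i) :=
  \sum_(c | P c) (coord_map (Y c) X i \o A c \o coord_map X (Y c) i)%VF.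

End Chains.

(* Main.v *)
(** A face [F] of the pair [(IN(M) - e, IN(M) / e)] is an independent set
    avoiding [e] such that [e |: F] is dependent, so [e |: F] contains exactly
    one circuit [C], and [e] lies in [C]; the faces with a given [C] are those of
    [(C :\ e) o IN(M / C)].  If one face is contained in another, the circuit of
    the smaller one is also the circuit of the larger one. Hence the boundary
    operators, and with them the Laplacians, are block diagonal. *)
Require Import Defs.
From mathcomp Require Import all_boot all_order all_algebra.
From mathcomp Require Import reals.

Set Implicit Arguments.
Unset Strict Implicit.
Unset Printing Implicit Defensive.

Import Order.TTheory GRing.Theory Num.Theory.
Local Open Scope ring_scope.

(** * Circuits, contraction by a circuit, and the faces of the pair *)

Section MatroidCircuits.
Variables (T : finType) (M : matroid T).
Implicit Types (B C F G I J : {set T}) (e : T).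

(** A maximal independent [K] between [I] and [I :|: J] cannot be augmented from [J], so it is at
    least as large as [J]. This form of the exchange property serves both circuit uniqueness and the
    change of basis in a contraction. *)
Lemma indep_extend I J : I \in indep M -> J \in indep M ->
  exists K : {set T}, [/\ K \in indep M, I \subset K, K \subset I :|: J
                        & (#|J| <= #|K|)%N].
Proof.
move=> II JI.
have [|K /maxsetP[/andP[KIJ KI] maxK] IK] :=
  @maxset_exists _ [pred K : {set T} | (K \subset I :|: J) && (K \in indep M)] I.
  by rewrite inE subsetUl.
exists K; split=> //; rewrite leqNgt; apply/negP => /(indep_aug KI JI)[x].
rewrite inE => /andP[xK xJ] xKI; move: xK; rewrite -(maxK (x |: K)) ?setU11 //.
  by rewrite inE xKI subUset sub1set KIJ inE xJ orbT.
exact: subsetUr.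
Qed.

Lemma circuit_dep C : C \in circuits M -> C \notin indep M.
Proof. by rewrite inE => /minsetp/andP[]. Qed.

Lemma circuit_sub_ground C : C \in circuits M -> C \subset ground M.
Proof. by rewrite inE => /minsetp/andP[]. Qed.

Lemma circuit_indepD1 C x : C \in circuits M -> x \in C -> C :\ x \in indep M.
Proof.
rewrite inE => /minsetP[/andP[CE _] minC] xC; apply/negPn/negP => nI.
have /setP/(_ x) : C :\ x = C.
  by apply: minC; rewrite ?subD1set // inE nI (subset_trans (subD1set _ _)).
by rewrite !inE eqxx xC.
Qed.

Lemma circuit_basis_in C x :
  C \in circuits M -> x \in C -> basis_in M C (C :\ x).
Proof.
move=> cC xC; apply/maxsetP; split.
  by rewrite inE subD1set circuit_indepD1.
move=> B /andP[BC BI] CB; apply/eqP; rewrite eqEsubset CB andbT subsetD1 BC.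
apply/negP => xB; case/negP: (circuit_dep cC); apply: indepS BI.
by rewrite -(setD1K xC) subUset sub1set xB.
Qed.

Lemma dep_circuit F : F \subset ground M -> F \notin indep M ->
  exists2 C, C \in circuits M & C \subset F.
Proof.
move=> FE nF.
have [|C mC CF] := @minset_exists _
    [pred D : {set T} | (D \subset ground M) && (D \notin indep M)] F.
  by rewrite inE FE.
by exists C; rewrite // inE.
Qed.

(** If some [f] lies in [C] but not in [C'], extending [C :\ f] by elements of [I] yields an
    independent set that must be [e |: I] without [f], and this set contains [C']. *)
Lemma circuit_setU1_uniq e I C C' : I \in indep M ->
  C \in circuits M -> C \subset e |: I ->
  C' \in circuits M -> C' \subset e |: I -> C = C'.
Proof.
move=> II cC CI cC' C'I.
have [CC'|] := boolP (C \subset C').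
  move: (cC'); rewrite inE => /minsetP[_]; apply=> //.
  by rewrite inE circuit_sub_ground ?circuit_dep.
case/subsetPn => f fC fC'.
have [K [KI CK KCI IK]] := indep_extend (circuit_indepD1 cC fC) II.
have KeI : K \subset e |: I.
  by rewrite (subset_trans KCI) // subUset subsetUr andbT (subset_trans _ CI) ?subD1set.
have fK : f \notin K.
  apply/negP => fK; case/negP: (circuit_dep cC); apply: indepS KI.
  by rewrite -(setD1K fC) subUset sub1set fK.
(* [K] lies in the right-hand side, which has at most [#|I|] elements because [f] is removed, while
   [K] has at least [#|I|]. *)
have eqK : K = (e |: I) :\ f.
  apply/eqP; rewrite eqEcard subsetD1 KeI fK /=; apply: leq_trans IK.
  have := cardsD1 f (e |: I); rewrite (subsetP CI _ fC) add1n => fI.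
  by rewrite -ltnS -fI cardsU1; case: (e \notin I).
case/negP: (circuit_dep cC'); apply: indepS KI.
by rewrite eqK subsetD1 C'I.
Qed.

(** Contraction asks for some basis of [C]; exchange shows that the particular basis [C :\ e] serves
    for every [G]. *)
Lemma circuit_contract_indepE C e G : C \in circuits M -> e \in C ->
  (G \in indep (contract M C)) =
  [&& G \subset ground M, [disjoint G & C] & G :|: C :\ e \in indep M].
Proof.
move=> cC eC; rewrite /= inE subsetD -andbA; congr (_ && _).
apply/andP/andP => -[dGC].
  case/existsP=> B /andP[bB GBI]; split=> //.
  have bA := circuit_basis_in cC eC; have [AC AI] := basis_inP bA.
  have [BC BI] := basis_inP bB.
  (* Extend [C :\ e] instead of [B]. The result avoids [e], since it would otherwise contain [C], so
     it stays in [G :|: C :\ e]; two bases of [C] having equal size, it fills that set. *)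
  have [K [KI AK KU GBK]] := indep_extend AI GBI.
  have eK : e \notin K.
    apply/negP => eK; case/negP: (circuit_dep cC); apply: indepS KI.
    by rewrite -(setD1K eC) subUset sub1set eK.
  suff <- : K = G :|: C :\ e by [].
  apply/eqP; rewrite eqEcard; apply/andP; split.
    apply/subsetP => x xK; have := subsetP KU _ xK; rewrite !inE.
    case: (x \in G) => //=; rewrite ?orbT // => /orP[//|/(subsetP BC) ->].
    by rewrite andbT; apply: contraNneq eK => <-.
  apply: leq_trans GBK.
  have /eqP -> : #|G :|: B| == (#|G| + #|B|)%N.
    by rewrite (leq_card_setU G B).2 (disjointWr BC).
  apply: leq_trans (leq_card_setU _ _).1 _.
  by rewrite leq_add2l (leq_card_basis_in bB bA).
move=> GI; split=> //; apply/existsP; exists (C :\ e).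
by rewrite circuit_basis_in.
Qed.

(** When [e] is outside [F] and [C] is inside [e |: F], the part of [F] in [C] is exactly [C :\ e],
    so [F :\: C] is the only candidate for the face of the contraction. *)
Lemma circ_contractP C e F : C \in circuits M -> e \in C ->
  (F \in circ (C :\ e) (IN (contract M C))) =
  [&& F \in indep M, e \notin F & C \subset e |: F].
Proof.
move=> cC eC; apply/imsetP/and3P.
  case=> G; rewrite (circuit_contract_indepE _ cC eC) => /and3P[_ dGC GI] ->.
  rewrite setUC GI; split=> //; last by rewrite setUCA setD1K ?subsetUr.
  by rewrite !inE eqxx (disjointFl dGC).
case=> FI eF CF.
have CeF : C :\ e \subset F by rewrite subDset.
have FC : F :\: C :|: C :\ e = F.
  apply/setP => x; rewrite !inE; case: (boolP (x \in C)) => xC /=.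
    rewrite andbT; apply/idP/idP => [xe|xF].
      by apply: (subsetP CeF); rewrite !inE xe.
    by apply: contraNneq eF => <-.
  by rewrite andbF orbF.
exists (F :\: C); last by rewrite setUC FC.
rewrite (circuit_contract_indepE _ cC eC) FC FI andbT.
rewrite (subset_trans (subsetDl _ _) (indep_sub_ground FI)) /=.
by rewrite -setI_eq0 setIDAC -setIDA setDv setI0.
Qed.

Lemma del_link_facesE e F :
  (F \in faces (del (IN M) e) :\: faces (link (IN M) e)) =
  [&& F \in indep M, e \notin F & e |: F \notin indep M].
Proof.
rewrite !inE andbC -andbA; congr (_ && _); case: (boolP (e \in F)) => //= eF.
congr (~~ _); apply/imsetP/idP => [[G]|eFI].
  by rewrite inE => /andP[GI eG] ->; rewrite setD1K.
by exists (e |: F); rewrite ?setU1K // inE eFI setU11.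
Qed.

End MatroidCircuits.

(** * Matrices of Laplacians and of direct sums *)

Section Laplacians.
Variables (R : realType) (d : Order.disp_t) (T : finOrderType d).
Implicit Types (X : {set {set T}}) (F G H : {set T}) (i j : int).

Lemma eq_hom_of (I J : finType) (a b : J -> I -> R) :
  a =2 b -> hom_of a = hom_of b.
Proof.
move=> ab; apply/lfunP => x; apply/ffunP => j.
by rewrite !hom_ofE; apply: eq_bigr => k _; rewrite ab.
Qed.

Lemma hom_of_comp (I J K : finType) (a : J -> I -> R) (b : K -> J -> R) :
  (hom_of b \o hom_of a)%VF = hom_of (fun l k => \sum_j b l j * a j k).
Proof.
apply/lfunP => x; apply/ffunP => l; rewrite comp_lfunE !hom_ofE.
under eq_bigr => j _ do rewrite hom_ofE mulr_sumr.
rewrite exchange_big; apply: eq_bigr => k _; rewrite mulr_suml.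
by apply: eq_bigr => j _; rewrite mulrA.
Qed.

Lemma hom_ofD (I J : finType) (a b : J -> I -> R) :
  hom_of a + hom_of b = hom_of (fun l k => a l k + b l k).
Proof.
apply/lfunP => x; apply/ffunP => l; rewrite add_lfunE ffunE !hom_ofE -big_split.
by apply: eq_bigr => k _; rewrite mulrDl.
Qed.

Lemma hom_of_sum (I J K : finType) (P : pred K) (a : K -> J -> I -> R) :
  \sum_(c | P c) hom_of (a c) = hom_of (fun l k => \sum_(c | P c) a c l k).
Proof.
apply/lfunP => x; apply/ffunP => l; rewrite sum_lfunE sum_ffunE hom_ofE.
under eq_bigr => c _ do rewrite hom_ofE.
by rewrite exchange_big; apply: eq_bigr => k _; rewrite mulr_suml.
Qed.

Lemma adjoint_hom_of (I J : finType) (a : J -> I -> R) :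
  adjoint (hom_of a) = hom_of (fun k l => a l k).
Proof.
apply: eq_hom_of => k l; rewrite hom_ofE (bigD1 k) //= ffunE eqxx mulr1.
by rewrite big1 ?addr0 // => k' /negPf k'k; rewrite ffunE k'k mulr0.
Qed.

Lemma sum_face X i (f : {set T} -> R) :
  \sum_(F : face X i) f (val F) = \sum_(F | (F \in X) && (Defs.dim F == i)) f F.
Proof. by rewrite [RHS](big_sub [pred F | (F \in X) && (Defs.dim F == i)]). Qed.

(** The matrix entry of the Laplacian, over common cofaces and then common facets. [F] and [G] are
    plain sets, so that entries for different [X] can be compared. *)
Definition laplacian_coef X i F G : R :=
  \sum_(H | (H \in X) && (Defs.dim H == i + 1)) incidence R H F * incidence R H G
  + \sum_(H | (H \in X) && (Defs.dim H == i - 1)) incidence R F H * incidence R G H.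

Lemma laplacianE X i :
  laplacian R X i = hom_of (fun F G : face X i => laplacian_coef X i (val F) (val G)).
Proof.
rewrite /laplacian /boundary !adjoint_hom_of !hom_of_comp hom_ofD.
apply: eq_hom_of => F G; congr (_ + _).
  exact: (sum_face X (i + 1) (fun H => incidence R H (val F) * incidence R H (val G))).
exact: (sum_face X (i - 1) (fun H => incidence R (val F) H * incidence R (val G) H)).
Qed.

Lemma sum_face_delta X i G (f : {set T} -> R) : Defs.dim G = i ->
  \sum_(F : face X i) f (val F) * (val F == G)%:R = (G \in X)%:R * f G.
Proof.
move=> dG; rewrite (sum_face _ _ (fun F => f F * (F == G)%:R)).
have [GX|GX] := boolP (G \in X).
  rewrite (bigD1 G) ?GX ?dG ?eqxx //= mulr1 mul1r big1 ?addr0 //.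
  by move=> F /andP[_ /negPf ->]; rewrite mulr0.
rewrite mul0r big1 // => F /andP[FX _]; case: eqVneq => [FG|]; rewrite ?mulr0 //.
by rewrite -FG FX in GX.
Qed.

(** The projection and the inclusion around each block keep only the entries with both indices in
    [Y c], whence the two indicators. *)
Lemma dirsum_hom_of (I : finType) (P : pred I) (Y : I -> {set {set T}}) X i
    (f : I -> {set T} -> {set T} -> R) :
  dirsum P X (fun c => hom_of (fun F G : face (Y c) i => f c (val F) (val G))) =
  hom_of (fun F G : face X i => \sum_(c | P c)
    (val F \in Y c)%:R * (val G \in Y c)%:R * f c (val F) (val G)).
Proof.
rewrite /dirsum -hom_of_sum; apply: eq_bigr => c _.
rewrite /coord_map !hom_of_comp; apply: eq_hom_of => F G.
have dG : Defs.dim (val G) = i by case/andP: (valP G) => _ /eqP.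
have dF : Defs.dim (val F) = i by case/andP: (valP F) => _ /eqP.
under eq_bigr => G' _.
  under eq_bigr => F' _ do rewrite mulrC.
  rewrite (sum_face_delta _ (fun F' => f c F' (val G'))) //.
  rewrite (eq_sym (val G)).
  over.
rewrite (sum_face_delta _ (fun G' => (val F \in Y c)%:R * f c (val F) G')) //.
by rewrite mulrCA mulrA.
Qed.

Lemma incidence_neq0_sub F G : incidence R F G != 0 -> G \subset F.
Proof.
apply: contraNT => nGF; rewrite /incidence big_pred0 // => v.
by apply: contraNF nGF => /andP[_ /eqP <-]; rewrite subD1set.
Qed.

(** A nonzero incidence forces containment, hence membership in the same block. So the intermediate
    faces [H] in an entry of the Laplacian never leave the block of [F], and entries across blocks
    vanish. *)
Lemma laplacian_dirsum (I : finType) (P : pred I) (Y : I -> {set {set T}}) X i :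
  (forall c c', P c -> P c' -> c != c' -> [disjoint Y c & Y c']) ->
  X = \bigcup_(c | P c) Y c ->
  (forall c F G, P c -> F \in X -> G \in X -> F \subset G ->
     (F \in Y c) = (G \in Y c)) ->
  laplacian R X i = dirsum P X (fun c => laplacian R (Y c) i).
Proof.
move=> disY defX subY.
have YX c F : P c -> F \in Y c -> F \in X.
  by move=> Pc FY; rewrite defX; apply/bigcupP; exists c.
have incY c F G : P c -> F \in X -> G \in X -> incidence R F G != 0 ->
    (F \in Y c) = (G \in Y c).
  by move=> Pc FX GX /incidence_neq0_sub GF; rewrite (subY c G F).
(* The family of operators is dependently typed, so it is rewritten under the unfolded sum, which is
   then folded back. *)
rewrite /dirsum; under eq_bigr => c _ do rewrite laplacianE.
rewrite -/(dirsum _ _ _) (dirsum_hom_of _ _ _ _ (fun c => laplacian_coef (Y c) i)).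
rewrite laplacianE; apply: eq_hom_of => F G.
have /andP[FX _] := valP F; have /andP[GX _] := valP G.
have /bigcupP[c Pc FY] : val F \in \bigcup_(c | P c) Y c by rewrite -defX.
(* By disjointness only the block [c] containing [F] contributes. *)
rewrite (bigD1 c) //= big1 ?addr0; last first.
  move=> c' /andP[Pc' c'c]; have := disY _ _ Pc' Pc c'c.
  by move=> /disjointFl ->; rewrite ?mul0r.
rewrite FY mul1r /laplacian_coef mulrDr !mulr_sumr.
(* One statement for both halves of the entry: [g] is the incidence or its transpose. A nonzero
   product puts [H], and then [G], in the block of [F]. *)
have restr (j : int) (g : {set T} -> {set T} -> R) :
    (forall H, H \in X -> g (val F) H != 0 -> (val F \in Y c) = (H \in Y c)) ->
    (forall H, H \in X -> g (val G) H != 0 -> (val G \in Y c) = (H \in Y c)) ->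
    \sum_(H | (H \in X) && (Defs.dim H == j)) g (val F) H * g (val G) H =
    \sum_(H | (H \in Y c) && (Defs.dim H == j))
      (val G \in Y c)%:R * (g (val F) H * g (val G) H).
  move=> gF gG; rewrite [RHS]big_mkcond [LHS]big_mkcond; apply: eq_bigr => H _ /=.
  case: (Defs.dim H == j); rewrite ?andbF // !andbT.
  have [HX|HX] := boolP (H \in X); last by rewrite (contraNF (YX c H Pc) HX).
  have [->|/gF-/(_ HX)] := eqVneq (g (val F) H) 0.
    by rewrite mul0r mulr0 if_same.
  rewrite FY => /esym HY; rewrite HY.
  have [->|/gG-/(_ HX) ->] := eqVneq (g (val G) H) 0; first by rewrite !mulr0.
  by rewrite HY mul1r.
congr (_ + _).
  by apply: (restr _ (fun F H => incidence R H F)) => H HX /(incY c) ->.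
by apply: (restr _ (fun F H => incidence R F H)) => H HX /(incY c) ->.
Qed.

End Laplacians.

(** * Decomposition of the pair by the circuits through [e] *)

Theorem lemma3p3 (R : realType) (d : Order.disp_t) (T : finOrderType d)
    (M : matroid T) (e : T) (he : e \in ground M) (hloop : ~~ loop M e) :
  let X := faces (del (IN M) e) :\: faces (link (IN M) e) in
  let Y := fun C : {set T} => circ (C :\ e) (IN (contract M C)) in
  let P := fun C : {set T} => (C \in circuits M) && (e \in C) in
  [/\ forall C C' : {set T}, P C -> P C' -> C != C' -> [disjoint Y C & Y C'],
      X = \bigcup_(C | P C) Y C
    & forall i : int,
        laplacian R X i = dirsum P X (fun C => laplacian R (Y C) i)].
Proof.
move=> X Y P.
have inX F : (F \in X) = [&& F \in indep M, e \notin F & e |: F \notin indep M].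
  exact: del_link_facesE.
have inY C F : P C -> (F \in Y C) = [&& F \in indep M, e \notin F & C \subset e |: F].
  by case/andP=> cC eC; apply: circ_contractP.
have uniqC C C' F : P C -> P C' -> F \in indep M ->
    C \subset e |: F -> C' \subset e |: F -> C = C'.
  by move=> /andP[cC _] /andP[cC' _] FI CF; apply: (circuit_setU1_uniq FI).
have disY C C' : P C -> P C' -> C != C' -> [disjoint Y C & Y C'].
  move=> PC PC' CC'; rewrite disjoint_subset; apply/subsetP => F.
  rewrite inE /= !inY // => /and3P[FI -> CF]; rewrite FI /=.
  by apply: contra CC' => C'F; apply/eqP; apply: uniqC C'F.
have defX : X = \bigcup_(C | P C) Y C.
  apply/setP => F; rewrite inX; apply/and3P/bigcupP.
    case=> FI eF eFI; have [|C cC CF] := dep_circuit _ eFI.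
      by rewrite subUset sub1set he indep_sub_ground.
    have PC : P C.
      (* A circuit in [e |: F] that avoided [e] would lie in the independent set [F]. *)
      rewrite /P cC; apply: contraNT (circuit_dep cC) => eC.
      by apply: indepS FI; apply: subset_trans (_ : C :\ e \subset F); rewrite ?subDset // subsetD1 subxx.
    by exists C; rewrite ?inY ?FI ?eF.
  case=> C PC; rewrite inY // => /and3P[FI eF CF]; split=> //.
  case/andP: PC => cC _; apply: contra (circuit_dep cC); exact: indepS.
split=> // i; apply: laplacian_dirsum => // C F G PC.
rewrite {1}defX !inX => /bigcupP[C' PC' FC'] /and3P[GI eG _] FG.
move: FC'; rewrite !inY // => /and3P[FI eF C'F]; rewrite FI eF GI eG /=.
(* The circuit [C'] of [F] also lies in [e |: G]; if [C] does too, uniqueness there gives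
   [C = C']. *)
have FGe : e |: F \subset e |: G by apply: setUS.
apply/idP/idP => [CF|CG]; first exact: subset_trans FGe.
by rewrite (uniqC _ _ _ PC PC' GI CG (subset_trans C'F FGe)).
Qed.
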